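(* Let $M$ be a commutative monoid with identity $e$. (i) For every symmetric monoidal abelian groupoid $\mathcal{M}$ there exist a commutative monoid $M$, an $\mathbb{H}M$-module $\mathcal{A}$, a cocycle $(g,\mu)\in Z^5(M,3;\mathcal{A})$ and a symmetric monoidal equivalence $\mathcal{A}\rtimes_{g,\mu}M\simeq\mathcal{M}$. (ii) Let $M,M'$ be commutative monoids, $\mathcal{A}$ an $\mathbb{H}M$-module, $\mathcal{A}'$ an $\mathbb{H}M'$-module, $(g,\mu)\in Z^5(M,3;\mathcal{A})$ and $(g',\mu')\in Z^5(M',3;\mathcal{A}')$. Then there is a symmetric monoidal equivalence $\mathcal{A}\rtimes_{g,\mu}M\simeq\mathcal{A}'\rtimes_{g',\mu'}M'$ if and only if there exist an isomorphism of monoids $i:M\cong M'$ and a natural isomorphism of $\mathbb{H}M$-modules $\psi:\mathcal{A}\cong i^*\mathcal{A}'$ such that $[g,\mu]=\psi_*^{-1}\,i^*[g',\mu']$ in $H^5(M,3;\mathcal{A})$.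
   Context: For a commutative monoid $M$ (identity $e$), $\mathbb{H}M$ is the category with object set $M$ and morphisms $(x,y):x\to xy$ for $(x,y)\in M^2$, composition $(xy,z)(x,y)=(x,yz)$. An $\mathbb{H}M$-module is a functor $\mathcal{A}:\mathbb{H}M\to\mathbf{Ab}$, i.e. abelian groups $\mathcal{A}(x)$ ($x\in M$) with homomorphisms $y_*:\mathcal{A}(x)\to\mathcal{A}(xy)$ satisfying $y_*z_*=(yz)_*$, $e_*=\mathrm{id}$; morphisms are natural transformations. Cochains: a function $f$ on $M^n$ is ''normalized with values in $\mathcal{A}$'' if $f(x_1,\dots,x_n)\in\mathcal{A}(x_1\cdots x_n)$ and $f$ vanishes whenever some $x_i=e$. $Z^5(M,3;\mathcal{A})$ is the group of pairs $(g,\mu)$ of normalized functions $g:M^3\to\bigcup_x\mathcal{A}(x)$, $\mu:M^2\to\bigcup_x\mathcal{A}(x)$ satisfying, for all $x,y,z,t$: $x_*g(y,z,t)-g(xy,z,t)+g(x,yz,t)-g(x,y,zt)+t_*g(x,y,z)=0$, $y_*\mu(x,z)-\mu(x,yz)+z_*\mu(x,y)-g(x,y,z)+g(y,x,z)-g(y,z,x)=0$, $x_*\mu(y,z)-\mu(xy,z)+y_*\mu(x,z)+g(x,y,z)-g(x,z,y)+g(z,x,y)=0$, $\mu(x,y)+\mu(y,x)=0$. $B^5(M,3;\mathcal{A})$ consists of the pairs $(g,\mu)$ with $g(x,y,z)=-x_*f(y,z)+f(xy,z)-f(x,yz)+z_*f(x,y)$ and $\mu(x,y)=f(x,y)-f(y,x)$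 for some normalized $f:M^2\to\bigcup_x\mathcal{A}(x)$. $H^5(M,3;\mathcal{A})=Z^5/B^5$ (the paper's third-level fifth cohomology group of $M$, which it defines via the iterated bar construction of the free $\mathbb{H}M$-algebra $\mathcal{Z}M$ and computes by these normalized cochains). If $i:M\to M'$ is a monoid homomorphism and $\mathcal{A}'$ an $\mathbb{H}M'$-module, $i^*\mathcal{A}'$ is the $\mathbb{H}M$-module $x\mapsto\mathcal{A}'(ix)$ with $y$ acting by $(iy)_*$; $i^*[g',\mu']$ is the class of $((x,y,z)\mapsto g'(ix,iy,iz),(x,y)\mapsto\mu'(ix,iy))$ in $H^5(M,3;i^*\mathcal{A}')$, and $\psi_*:H^5(M,3;\mathcal{A})\to H^5(M,3;i^*\mathcal{A}')$ is induced by applying $\psi$ to cochain values. A groupoid is abelian if all automorphism groups are abelian (written additively). A symmetric monoidal abelian groupoid $(\mathcal{M},\otimes,\mathrm{I},\boldsymbol a,\boldsymbol l,\boldsymbol r,\boldsymbol c)$ is an abelian groupoid with a tensor functor, unit object and natural isomorphisms $\boldsymbol a:(x\otimes y)\otimes z\to x\otimes(y\otimes z)$, $\boldsymbol l:\mathrm{I}\otimes x\to x$, $\boldsymbol r:x\otimes\mathrm{I}\to x$, $\boldsymbol c:x\otimes y\to y\otimes x$ satisfying the pentagon, triangle and hexagon axioms and $\boldsymbol c_{y,x}\boldsymbol c_{x,y}=\mathrm{id}$ (i.e. a symmetric monoidal category whose underlying category is an abelian groupoid). Symmetric monoidal functors and symmetric monoidal natural isomorphisms are the usual ones (with structure isomorphisms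 $F x\otimes Fy\cong F(x\otimes y)$, $\mathrm{I}'\cong F\mathrm{I}$ compatible with $\boldsymbol a,\boldsymbol l,\boldsymbol r,\boldsymbol c$); a symmetric monoidal equivalence is a symmetric monoidal functor that is an equivalence in the 2-category of symmetric monoidal abelian groupoids, symmetric monoidal functors and symmetric monoidal isomorphisms. For $(g,\mu)\in Z^5(M,3;\mathcal{A})$, the crossed product $\mathcal{A}\rtimes_{g,\mu}M$ is the symmetric monoidal abelian groupoid with object set $M$, no morphisms between distinct objects, automorphism group $\mathcal{A}(x)$ at $x$; tensor $x\otimes y=xy$ on objects and $a_x\otimes a_y=y_*a_x+x_*a_y$ for $a_x\in\mathcal{A}(x),a_y\in\mathcal{A}(y)$; unit $e$; $\boldsymbol a_{x,y,z}=g(x,y,z)$, $\boldsymbol c_{x,y}=\mu(x,y)$, $\boldsymbol l_x=\boldsymbol r_x=0_x$. *)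

(* Defs.v *)
From HB Require Import structures.
From mathcomp Require Import all_boot all_algebra.
Set Implicit Arguments. Unset Strict Implicit. Unset Printing Implicit Defensive.
Import GRing.Theory.
Local Open Scope ring_scope.

Record comMonoid := ComMonoid {
  cm_car :> Type;
  cm_op : cm_car -> cm_car -> cm_car;
  cm_e : cm_car;
  cm_opA : associative cm_op;
  cm_opC : commutative cm_op;
  cm_op1m : left_id cm_e cm_op }.
Arguments cm_op {c}.
Arguments cm_e {c}.
Notation "x ⊙ y" := (cm_op x y) (at level 40, left associativity).

Lemma cm_opm1 (M : comMonoid) (x : M) : x ⊙ cm_e = x.
Proof. by rewrite cm_opC cm_op1m. Qed.

Record cmhom (M M' : comMonoid) := CMHom {
  cmh_fun :> M -> M';
  cmh_mul : forall x y, cmh_fun (x ⊙ y) = cmh_fun x ⊙ cmh_fun y;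
  cmh_one : cmh_fun cm_e = cm_e }.

(* equalities in M used to identify the groups A(w) for equal w *)
Section MonoidEqs.
Variable M : comMonoid.
Implicit Types x y z t : M.
Lemma cmE1 x y z t : y ⊙ z ⊙ t ⊙ x = x ⊙ y ⊙ z ⊙ t.
Proof. by rewrite cm_opC !cm_opA. Qed.
Lemma cmE2 x y z t : x ⊙ (y ⊙ z) ⊙ t = x ⊙ y ⊙ z ⊙ t.
Proof. by rewrite !cm_opA. Qed.
Lemma cmE3 x y z t : x ⊙ y ⊙ (z ⊙ t) = x ⊙ y ⊙ z ⊙ t.
Proof. by rewrite !cm_opA. Qed.
Lemma cmF1 x y z : x ⊙ z ⊙ y = x ⊙ y ⊙ z.
Proof. by rewrite -!cm_opA (cm_opC z). Qed.
Lemma cmF3 x y z : y ⊙ x ⊙ z = x ⊙ y ⊙ z.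
Proof. by rewrite (cm_opC y). Qed.
Lemma cmF4 x y z : y ⊙ z ⊙ x = x ⊙ y ⊙ z.
Proof. by rewrite cm_opC cm_opA. Qed.
Lemma cmF5 x y z : z ⊙ x ⊙ y = x ⊙ y ⊙ z.
Proof. by rewrite (cm_opC z) cmF1. Qed.
End MonoidEqs.

Lemma cmh_mul3 (M M' : comMonoid) (i : cmhom M M') (x y z : M) :
  i x ⊙ i y ⊙ i z = i (x ⊙ y ⊙ z).
Proof. by rewrite !cmh_mul. Qed.

(* HM-modules: functors HM -> Ab, given by abelian groups A(x) and     *)
(* maps y_* : A(x) -> A(xy).                                           *)
Record hmod (M : comMonoid) := HMod {
  hm_grp :> M -> zmodType;
  hm_act : forall x y : M, hm_grp x -> hm_grp (x ⊙ y) }.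
Arguments hm_act {M} _ _ _.

Definition hcast (M : comMonoid) (N : hmod M) (x y : M) (p : x = y) (a : N x) : N y :=
  match p in _ = z return N z with erefl => a end.
Arguments hcast {M} N {x y} p a.

Definition is_hmod (M : comMonoid) (N : hmod M) : Prop :=
  (forall x y (a b : N x), hm_act N x y (a + b) = hm_act N x y a + hm_act N x y b) /\
  (forall x (a : N x), hcast N (cm_opm1 x) (hm_act N x cm_e a) = a) /\
  (forall x y z (a : N x),
      hm_act N (x ⊙ y) z (hm_act N x y a) = hcast N (cm_opA x y z) (hm_act N x (y ⊙ z) a)).

Definition hmod_iso (M : comMonoid) (N N' : hmod M)
    (psi : forall x, N x -> N' x) (psiinv : forall x, N' x -> N x) : Prop :=
  (forall x (a b : N x), psi x (a + b) = psi x a + psi x b) /\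
  (forall x y (a : N x), psi (x ⊙ y) (hm_act N x y a) = hm_act N' x y (psi x a)) /\
  (forall x (a : N x), psiinv x (psi x a) = a) /\
  (forall x (b : N' x), psi x (psiinv x b) = b).

Definition pullback (M M' : comMonoid) (i : cmhom M M') (N' : hmod M') : hmod M :=
  @HMod M (fun x => N' (i x))
    (fun x y a => hcast N' (esym (cmh_mul i x y)) (hm_act N' (i x) (i y) a)).

Definition cochain3 (M : comMonoid) (N : hmod M) := forall x y z : M, N (x ⊙ y ⊙ z).
Definition cochain2 (M : comMonoid) (N : hmod M) := forall x y : M, N (x ⊙ y).

Definition normal3 (M : comMonoid) (N : hmod M) (g : cochain3 N) : Prop :=
  (forall y z, g cm_e y z = 0) /\ (forall x z, g x cm_e z = 0) /\ (forall x y, g x y cm_e = 0).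
Definition normal2 (M : comMonoid) (N : hmod M) (f : cochain2 N) : Prop :=
  (forall y, f cm_e y = 0) /\ (forall x, f x cm_e = 0).

Definition Z5 (M : comMonoid) (N : hmod M) (g : cochain3 N) (mu : cochain2 N) : Prop :=
  normal3 g /\ normal2 mu /\
  (forall x y z t,
      hcast N (cmE1 x y z t) (hm_act N (y ⊙ z ⊙ t) x (g y z t)) - g (x ⊙ y) z t
    + hcast N (cmE2 x y z t) (g x (y ⊙ z) t) - hcast N (cmE3 x y z t) (g x y (z ⊙ t))
    + hm_act N (x ⊙ y ⊙ z) t (g x y z) = 0) /\
  (forall x y z,
      hcast N (cmF1 x y z) (hm_act N (x ⊙ z) y (mu x z)) - hcast N (cm_opA x y z) (mu x (y ⊙ z))
    + hm_act N (x ⊙ y) z (mu x y) - g x y z + hcast N (cmF3 x y z) (g y x z)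
    - hcast N (cmF4 x y z) (g y z x) = 0) /\
  (forall x y z,
      hcast N (cmF4 x y z) (hm_act N (y ⊙ z) x (mu y z)) - mu (x ⊙ y) z
    + hcast N (cmF1 x y z) (hm_act N (x ⊙ z) y (mu x z)) + g x y z
    - hcast N (cmF1 x y z) (g x z y) + hcast N (cmF5 x y z) (g z x y) = 0) /\
  (forall x y, mu x y + hcast N (cm_opC y x) (mu y x) = 0).

Definition B5 (M : comMonoid) (N : hmod M) (g : cochain3 N) (mu : cochain2 N) : Prop :=
  exists f : cochain2 N, normal2 f /\
    (forall x y z, g x y z =
        - hcast N (cmF4 x y z) (hm_act N (y ⊙ z) x (f y z)) + f (x ⊙ y) z
        - hcast N (cm_opA x y z) (f x (y ⊙ z)) + hm_act N (x ⊙ y) z (f x y)) /\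
    (forall x y, mu x y = f x y - hcast N (cm_opC y x) (f y x)).

Definition cohomologous (M : comMonoid) (N : hmod M)
    (g : cochain3 N) (mu : cochain2 N) (g2 : cochain3 N) (mu2 : cochain2 N) : Prop :=
  B5 (fun x y z => g x y z - g2 x y z) (fun x y => mu x y - mu2 x y).

Definition pull_g (M M' : comMonoid) (N : hmod M) (N' : hmod M') (i : cmhom M M')
    (psiinv : forall x, pullback i N' x -> N x) (g' : cochain3 N') : cochain3 N :=
  fun x y z => psiinv _ (hcast N' (cmh_mul3 i x y z) (g' (i x) (i y) (i z))).
Definition pull_mu (M M' : comMonoid) (N : hmod M) (N' : hmod M') (i : cmhom M M')
    (psiinv : forall x, pullback i N' x -> N x) (mu' : cochain2 N') : cochain2 N :=
  fun x y => psiinv _ (hcast N' (esym (cmh_mul i x y)) (mu' (i x) (i y))).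

Record smag_data := SMAG {
  ob :> Type;
  hom : ob -> ob -> Type;
  idm : forall x, hom x x;
  comp : forall x y z, hom y z -> hom x y -> hom x z;
  tens : ob -> ob -> ob;
  tensm : forall x x' y y', hom x x' -> hom y y' -> hom (tens x y) (tens x' y');
  tunit : ob;
  sassoc : forall x y z, hom (tens (tens x y) z) (tens x (tens y z));
  lunit : forall x, hom (tens tunit x) x;
  runit : forall x, hom (tens x tunit) x;
  braid : forall x y, hom (tens x y) (tens y x) }.
Arguments hom {s}. Arguments idm {s}. Arguments comp {s x y z}.
Arguments tens {s}. Arguments tensm {s x x' y y'}. Arguments tunit {s}.
Arguments sassoc {s}. Arguments lunit {s}. Arguments runit {s}. Arguments braid {s}.

Definition is_iso (C : smag_data) (x y : C) (f : hom x y) : Prop :=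
  exists h : hom y x, comp h f = idm x /\ comp f h = idm y.

Definition is_smag (C : smag_data) : Prop :=
  (forall x y z w : C, forall (f : hom x y) (g : hom y z) (h : hom z w),
      comp h (comp g f) = comp (comp h g) f) /\
  (forall x y : C, forall (f : hom x y), comp (idm y) f = f /\ comp f (idm x) = f) /\
  (forall x y : C, forall (f : hom x y), is_iso f) /\
  (forall x : C, forall (f g : hom x x), comp f g = comp g f) /\
  (forall x y : C, tensm (idm x) (idm y) = idm (tens x y)) /\
  (forall x x' x'' y y' y'' : C, forall (f : hom x x') (f' : hom x' x'') (g : hom y y') (g' : hom y' y''),
      tensm (comp f' f) (comp g' g) = comp (tensm f' g') (tensm f g)) /\
  (forall x x' y y' z z' : C, forall (f : hom x x') (g : hom y y') (h : hom z z'),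
      comp (sassoc x' y' z') (tensm (tensm f g) h) = comp (tensm f (tensm g h)) (sassoc x y z)) /\
  (forall x x' : C, forall (f : hom x x'), comp (lunit x') (tensm (idm tunit) f) = comp f (lunit x)) /\
  (forall x x' : C, forall (f : hom x x'), comp (runit x') (tensm f (idm tunit)) = comp f (runit x)) /\
  (forall x x' y y' : C, forall (f : hom x x') (g : hom y y'),
      comp (braid x' y') (tensm f g) = comp (tensm g f) (braid x y)) /\
  (forall w x y z : C,
      comp (tensm (idm w) (sassoc x y z)) (comp (sassoc w (tens x y) z) (tensm (sassoc w x y) (idm z)))
      = comp (sassoc w x (tens y z)) (sassoc (tens w x) y z)) /\
  (forall x y : C, comp (tensm (idm x) (lunit y)) (sassoc x tunit y) = tensm (runit x) (idm y)) /\
  (forall x y z : C,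
      comp (sassoc y z x) (comp (braid x (tens y z)) (sassoc x y z))
      = comp (tensm (idm y) (braid x z)) (comp (sassoc y x z) (tensm (braid x y) (idm z)))) /\
  (forall x y : C, comp (braid y x) (braid x y) = idm (tens x y)).

Record smfun (C D : smag_data) := SMFun {
  fob : C -> D;
  fhom : forall x y : C, hom x y -> hom (fob x) (fob y);
  fphi : forall x y : C, hom (tens (fob x) (fob y)) (fob (tens x y));
  fphi0 : hom (@tunit D) (fob tunit) }.
Arguments fob {C D} _ _.
Arguments fhom {C D} _ {_ _} _.
Arguments fphi {C D} _ _ _.
Arguments fphi0 {C D} _.

Definition is_smfun (C D : smag_data) (F : smfun C D) : Prop :=
  (forall x : C, fhom F (idm x) = idm (fob F x)) /\
  (forall x y z : C, forall (f : hom x y) (g : hom y z), fhom F (comp g f) = comp (fhom F g) (fhom F f)) /\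
  (forall x y : C, is_iso (fphi F x y)) /\ is_iso (fphi0 F) /\
  (forall x x' y y' : C, forall (f : hom x x') (g : hom y y'),
      comp (fhom F (tensm f g)) (fphi F x y) = comp (fphi F x' y') (tensm (fhom F f) (fhom F g))) /\
  (forall x y z : C,
      comp (fhom F (sassoc x y z)) (comp (fphi F (tens x y) z) (tensm (fphi F x y) (idm (fob F z))))
      = comp (fphi F x (tens y z)) (comp (tensm (idm (fob F x)) (fphi F y z))
                                         (sassoc (fob F x) (fob F y) (fob F z)))) /\
  (forall x : C, comp (fhom F (lunit x)) (comp (fphi F tunit x) (tensm (fphi0 F) (idm (fob F x))))
             = lunit (fob F x)) /\
  (forall x : C, comp (fhom F (runit x)) (comp (fphi F x tunit) (tensm (idm (fob F x)) (fphi0 F)))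
             = runit (fob F x)) /\
  (forall x y : C, comp (fhom F (braid x y)) (fphi F x y) = comp (fphi F y x) (braid (fob F x) (fob F y))).

Definition smfun_comp (C D E : smag_data) (G : smfun D E) (F : smfun C D) : smfun C E :=
  @SMFun C E (fun x => fob G (fob F x)) (fun x y f => fhom G (fhom F f))
    (fun x y => comp (fhom G (fphi F x y)) (fphi G (fob F x) (fob F y)))
    (comp (fhom G (fphi0 F)) (fphi0 G)).

Definition smfun_id (C : smag_data) : smfun C C :=
  @SMFun C C (fun x => x) (fun x y f => f) (fun x y => idm (tens x y)) (idm tunit).

Definition is_smnatiso (C D : smag_data) (F G : smfun C D)
    (th : forall x : C, hom (fob F x) (fob G x)) : Prop :=
  (forall x : C, is_iso (th x)) /\
  (forall x y : C, forall (f : hom x y), comp (th y) (fhom F f) = comp (fhom G f) (th x)) /\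
  (forall x y : C, comp (th (tens x y)) (fphi F x y) = comp (fphi G x y) (tensm (th x) (th y))) /\
  comp (th tunit) (fphi0 F) = fphi0 G.

Definition sm_equiv (C D : smag_data) : Prop :=
  exists (F : smfun C D) (G : smfun D C),
    is_smfun F /\ is_smfun G /\
    (exists th, is_smnatiso (F := smfun_comp G F) (G := smfun_id C) th) /\
    (exists th, is_smnatiso (F := smfun_comp F G) (G := smfun_id D) th).

Record xhom (M : comMonoid) (N : hmod M) (x y : M) := XHom { xh_eq : x = y; xh_val : N y }.
Arguments XHom {M N x y}.
Arguments xh_eq {M N x y}.
Arguments xh_val {M N x y}.

Definition crossed (M : comMonoid) (N : hmod M) (g : cochain3 N) (mu : cochain2 N) : smag_data :=
  @SMAG M (@xhom M N)
    (fun x => XHom (erefl x) 0)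
    (fun x y z h f => XHom (etrans (xh_eq f) (xh_eq h)) (hcast N (xh_eq h) (xh_val f) + xh_val h))
    (fun x y => x ⊙ y)
    (fun x x' y y' f h => XHom (congr2 cm_op (xh_eq f) (xh_eq h))
        (hm_act N x' y' (xh_val f) + hcast N (cm_opC y' x') (hm_act N y' x' (xh_val h))))
    cm_e
    (fun x y z => XHom (esym (cm_opA x y z)) (hcast N (esym (cm_opA x y z)) (g x y z)))
    (fun x => XHom (cm_op1m x) 0)
    (fun x => XHom (cm_opm1 x) 0)
    (fun x y => XHom (cm_opC x y) (hcast N (cm_opC x y) (mu x y))).

(* Main.v *)
From HB Require Import structures.
From mathcomp Require Import all_boot all_algebra.
From mathcomp Require Import boolp.
Require Import Defs.
Set Implicit Arguments. Unset Strict Implicit. Unset Printing Implicit Defensive.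
Import GRing.Theory.
Local Open Scope ring_scope.

(* (i) Choose a skeleton s : M -> C of the groupoid and isomorphisms
   φ(x,y) : s x ⊗ s y -> s (xy) with φ(e,y) = l and φ(x,e) = r, which is possible
   because l_I = r_I. Conjugating automorphisms along φ makes A(x) = Aut(s x) an
   HM-module; conjugation does not depend on the chosen isomorphism since all
   automorphism groups are abelian. The associator and the braiding read through
   φ give (g, mu), and s becomes a fully faithful, essentially surjective
   symmetric monoidal functor A ⋊ M -> C. Being faithful, it reflects the
   pentagon, the hexagon and the symmetry, which for a crossed product are the
   cocycle conditions.
   (ii) All morphisms of a crossed product are automorphisms, so a symmetric
   monoidal equivalence amounts to a bijection i on objects, isomorphisms psi of
   automorphism groups and a 2-cochain φ; compatibility with associators and
   braidings says that -psi^-1 φ, once normalized, bounds the difference of the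
   two cocycles. *)

(** * Abelian group identities and transport in modules *)

(** Reified group expressions: [zmod] decides an identity by computing with lists of variable
    indices. *)
Inductive zexpr := ZVar of nat | ZZero | ZAdd of zexpr & zexpr | ZOpp of zexpr.

Fixpoint zeval (V : zmodType) (env : seq V) (e : zexpr) : V :=
  match e with
  | ZVar n => nth 0 env n
  | ZZero => 0
  | ZAdd a b => zeval env a + zeval env b
  | ZOpp a => - zeval env a
  end.

Fixpoint zterms (e : zexpr) : seq nat * seq nat :=
  match e with
  | ZVar n => ([:: n], [::])
  | ZZero => ([::], [::])
  | ZAdd a b => ((zterms a).1 ++ (zterms b).1, (zterms a).2 ++ (zterms b).2)
  | ZOpp a => ((zterms a).2, (zterms a).1)
  end.

Lemma zevalE (V : zmodType) (env : seq V) (e : zexpr) :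
  zeval env e =
  \sum_(i <- (zterms e).1) nth 0 env i - \sum_(i <- (zterms e).2) nth 0 env i.
Proof.
elim: e => [n||a IHa b IHb|a IHa] /=.
- by rewrite big_seq1 big_nil subr0.
- by rewrite !big_nil subr0.
- by rewrite IHa IHb !big_cat /= opprD addrACA.
- by rewrite IHa opprB.
Qed.

(** Moving negative terms across leaves two sums of atoms; comparing their index lists up to
    permutation is a computation. *)
Lemma zeval_eq (V : zmodType) (env : seq V) (a b : zexpr) :
  perm_eq ((zterms a).1 ++ (zterms b).2) ((zterms b).1 ++ (zterms a).2) ->
  zeval env a = zeval env b.
Proof.
move=> E; apply/eqP; rewrite !zevalE subr_eq addrAC eq_sym subr_eq -!big_cat.
by rewrite (perm_big _ E).
Qed.

Ltac zmember x l :=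
  lazymatch l with
  | nil => constr:(false)
  | cons ?y ?l' =>
    match l' with
    | _ => let _ := match goal with _ => constr_eq x y end in constr:(true)
    | _ => zmember x l'
    end
  end.
Ltac zatoms e l :=
  lazymatch e with
  | 0%R => l
  | (?a + ?b)%R => let l' := zatoms a l in zatoms b l'
  | (- ?a)%R => zatoms a l
  | _ => lazymatch zmember e l with true => l | false => constr:(cons e l) end
  end.
Ltac zindex x l :=
  lazymatch l with
  | cons ?y ?l' =>
    match l' with
    | _ => let _ := match goal with _ => constr_eq x y end in constr:(O)
    | _ => let n := zindex x l' in constr:(S n)
    end
  end.
Ltac zreify e l :=
  lazymatch e with
  | 0%R => constr:(ZZero)
  | (?a + ?b)%R =>
    let a' := zreify a l in let b' := zreify b l in constr:(ZAdd a' b')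
  | (- ?a)%R => let a' := zreify a l in constr:(ZOpp a')
  | _ => let n := zindex e l in constr:(ZVar n)
  end.
(* Decides identities of abelian groups, atoms being compared syntactically. *)
Ltac zmod :=
  lazymatch goal with
  | |- @eq ?T ?a ?b =>
    let l0 := constr:(@nil T) in
    let l1 := zatoms a l0 in
    let l := zatoms b l1 in
    let a' := zreify a l in
    let b' := zreify b l in
    refine (@zeval_eq _ l a' b' _); vm_compute; reflexivity
  end.

(** Deduces a linear goal from a known relation [c = d]; the remaining premise is a pure group
    identity for [zmod]. *)
Lemma eq_of_eq (V : zmodType) (a b c d : V) : c = d -> a - b = c - d -> a = b.
Proof. by move=> -> /eqP; rewrite subrr subr_eq0 => /eqP. Qed.

Lemma hcast_irr (M : comMonoid) (N : hmod M) (x y : M) (p q : x = y) (a : N x) :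
  hcast N p a = hcast N q a.
Proof. by rewrite (Prop_irrelevance p q). Qed.

Lemma hcast_id (M : comMonoid) (N : hmod M) (x : M) (p : x = x) (a : N x) :
  hcast N p a = a.
Proof. by rewrite (Prop_irrelevance p erefl). Qed.

(** * Transport of elements along the action *)

Section Transp.
Variables (M : comMonoid) (N : hmod M).
Hypothesis HN : is_hmod N.
Implicit Types x y z u v w : M.

Lemma actD x y (a b : N x) : hm_act N x y (a + b) = hm_act N x y a + hm_act N x y b.
Proof. exact: HN.1. Qed.

Lemma act0 x y : hm_act N x y 0 = 0.
Proof. by apply: (addIr (hm_act N x y 0)); rewrite -actD !add0r. Qed.

(* Moves a into N w along u, with junk value 0 if x ⊙ u <> w. Unlike hcast and
   hm_act it takes no equality proof, so casts disappear under it. *)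
Definition transp w u x (a : N x) : N w :=
  match pselect (x ⊙ u = w) with
  | left p => hcast N p (hm_act N x u a)
  | right _ => 0
  end.

Lemma transpE w u x (p : x ⊙ u = w) (a : N x) :
  transp w u a = hcast N p (hm_act N x u a).
Proof. by rewrite /transp; case: pselect => // q; apply: hcast_irr. Qed.

Lemma transp_id w (a : N w) : transp w cm_e a = a.
Proof. by rewrite (transpE (cm_opm1 w)) HN.2.1. Qed.

Lemma transp_cast w u x y (p : x = y) (a : N x) : transp w u (hcast N p a) = transp w u a.
Proof. by case: y / p. Qed.

Lemma transp0 w u x : transp w u (0 : N x) = 0.
Proof. by rewrite /transp; case: pselect => // p; case: w / p; rewrite act0. Qed.

Lemma transpD w u x (a b : N x) : transp w u (a + b) = transp w u a + transp w u b.
Proof.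
rewrite /transp; case: pselect => [p|_]; last by rewrite addr0.
by case: w / p; rewrite actD.
Qed.

Lemma transpN w u x (a : N x) : transp w u (- a) = - transp w u a.
Proof. by apply/eqP; rewrite -addr_eq0 -transpD addNr transp0. Qed.

(** Functoriality of the action; by associativity of [⊙] the two equality tests agree, so the junk
    cases match too. *)
Lemma transp_act w u x v (a : N x) : transp w u (hm_act N x v a) = transp w (v ⊙ u) a.
Proof.
rewrite /(transp w u); case: pselect => [p|np].
  have q : x ⊙ (v ⊙ u) = w by rewrite cm_opA.
  rewrite (transpE q) HN.2.2; case: w / q p => p.
  by rewrite (Prop_irrelevance p (esym (cm_opA x v u))); move: (cm_opA x v u) => r; case: _ / r p.
rewrite /transp; case: pselect => // q; case: np; by rewrite -cm_opA.
Qed.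

(** Pushes [transp] down to atoms while absorbing casts and actions, so that all terms lie in one
    group. *)
Definition transpsimp := (transp_cast, transp_act, transpD, transpN, transp0).

Lemma xhom_eq x y (f h : @xhom M N x y) : xh_val f = xh_val h -> f = h.
Proof.
by case: f => p a; case: h => q b /= ->; rewrite (Prop_irrelevance p q).
Qed.

End Transp.
Arguments transp {M} N w u {x} a.

(** * Crossed products *)

Section Crossed.
Variables (M : comMonoid) (N : hmod M).
Hypothesis HN : is_hmod N.
Variables (g : cochain3 N) (mu : cochain2 N).
Implicit Types x y z t : M.

Local Notation D := (crossed g mu).

(** [transp_id], read backwards, puts both values under [transp]; after [transpsimp] only a group
    identity is left. *)
Ltac mvgoal := apply: xhom_eq => /=;
  rewrite -[LHS](transp_id HN) -[RHS](transp_id HN) !(transpsimp HN) ?cm_opm1.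

Lemma crossed_comp_assoc (x y z w : D) (f : hom x y) (h : hom y z) (k : hom z w) :
  comp k (comp h f) = comp (comp k h) f.
Proof. mvgoal; zmod. Qed.

Lemma crossed_comp_id (x y : D) (f : hom x y) : comp (idm y) f = f /\ comp f (idm x) = f.
Proof. split; mvgoal; zmod. Qed.

Lemma crossed_iso (x y : D) (f : hom x y) : is_iso f.
Proof.
exists (XHom (esym (xh_eq f)) (- hcast N (esym (xh_eq f)) (xh_val f)) : @hom D y x).
split; mvgoal; zmod.
Qed.

Lemma crossed_abelian (x : D) (f h : hom x x) : comp f h = comp h f.
Proof. mvgoal; zmod. Qed.

Lemma crossed_tens_id (x y : D) : tensm (idm x) (idm y) = idm (tens x y).
Proof. mvgoal; zmod. Qed.

Lemma crossed_tens_comp (x x' x'' y y' y'' : D) (f : hom x x') (f' : hom x' x'')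
    (h : hom y y') (h' : hom y' y'') :
  tensm (comp f' f) (comp h' h) = comp (tensm f' h') (tensm f h).
Proof.
(* Eliminating the equalities carried by the arrows makes the acting elements on the two sides
   coincide. *)
case: f' => pf' f'; case: x'' / pf' f' => f'; case: h' => ph' h'; case: y'' / ph' h' => h'.
mvgoal; zmod.
Qed.

Lemma crossed_assoc_nat (x x' y y' z z' : D) (f : hom x x') (h : hom y y') (k : hom z z') :
  comp (sassoc x' y' z') (tensm (tensm f h) k) = comp (tensm f (tensm h k)) (sassoc x y z).
Proof.
case: f => pf f; case: x' / pf f => f; case: h => ph h; case: y' / ph h => h;
case: k => pk k; case: z' / pk k => k.
(* The acting products appear in both orders, and [zmod] compares atoms syntactically. *)
mvgoal; rewrite (cm_opC z x) (cm_opC y x).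
zmod.
Qed.

Lemma crossed_lunit_nat (x x' : D) (f : hom x x') :
  comp (lunit x') (tensm (idm tunit) f) = comp f (lunit x).
Proof. mvgoal; zmod. Qed.

Lemma crossed_runit_nat (x x' : D) (f : hom x x') :
  comp (runit x') (tensm f (idm tunit)) = comp f (runit x).
Proof. mvgoal; zmod. Qed.

Lemma crossed_braid_nat (x x' y y' : D) (f : hom x x') (h : hom y y') :
  comp (braid x' y') (tensm f h) = comp (tensm h f) (braid x y).
Proof.
case: f => pf f; case: x' / pf f => f; case: h => ph h; case: y' / ph h => h.
mvgoal; zmod.
Qed.

Definition pentagon (C : smag_data) := forall w x y z : C,
  comp (tensm (idm w) (sassoc x y z)) (comp (sassoc w (tens x y) z) (tensm (sassoc w x y) (idm z)))
  = comp (sassoc w x (tens y z)) (sassoc (tens w x) y z).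

Definition hexagon (C : smag_data) := forall x y z : C,
  comp (sassoc y z x) (comp (braid x (tens y z)) (sassoc x y z))
  = comp (tensm (idm y) (braid x z)) (comp (sassoc y x z) (tensm (braid x y) (idm z))).

Definition symmetry_law (C : smag_data) := forall x y : C,
  comp (braid y x) (braid x y) = idm (tens x y).

Definition assoc_cocycle := forall x y z t,
  hcast N (cmE1 x y z t) (hm_act N (y ⊙ z ⊙ t) x (g y z t)) - g (x ⊙ y) z t
    + hcast N (cmE2 x y z t) (g x (y ⊙ z) t) - hcast N (cmE3 x y z t) (g x y (z ⊙ t))
    + hm_act N (x ⊙ y ⊙ z) t (g x y z) = 0.

Definition hexagon_cocycle := forall x y z,
  hcast N (cmF1 x y z) (hm_act N (x ⊙ z) y (mu x z)) - hcast N (cm_opA x y z) (mu x (y ⊙ z))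
    + hm_act N (x ⊙ y) z (mu x y) - g x y z + hcast N (cmF3 x y z) (g y x z)
    - hcast N (cmF4 x y z) (g y z x) = 0.

Definition symmetry_cocycle := forall x y, mu x y + hcast N (cm_opC y x) (mu y x) = 0.

(** Composition adds values and tensoring with an identity is the action, so both statements are the
    same linear relation up to transport. *)
Lemma pentagon_crossed : pentagon D <-> assoc_cocycle.
Proof.
split=> H x y z t.
  have := congr1 (@xh_val _ _ _ _) (H x y z t) => /= /(congr1 (transp N (x ⊙ y ⊙ z ⊙ t) cm_e)).
  rewrite !(transpsimp HN) ?cm_opm1 => E.
  rewrite -[LHS](transp_id HN) !(transpsimp HN) ?cm_opm1.
  apply: (eq_of_eq E); zmod.
have /(congr1 (transp N (x ⊙ (y ⊙ (z ⊙ t))) cm_e)) := H x y z t.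
rewrite !(transpsimp HN) ?cm_opm1 => E.
mvgoal.
apply: (eq_of_eq E); zmod.
Qed.

Lemma hexagon_crossed : hexagon D <-> hexagon_cocycle.
Proof.
split=> H x y z.
  have := congr1 (@xh_val _ _ _ _) (H x y z) => /= /(congr1 (transp N (x ⊙ y ⊙ z) cm_e)).
  rewrite !(transpsimp HN) ?cm_opm1 => E.
  rewrite -[LHS](transp_id HN) !(transpsimp HN) ?cm_opm1.
  apply: (eq_of_eq (esym E)); zmod.
have /(congr1 (transp N (y ⊙ (z ⊙ x)) cm_e)) := H x y z.
rewrite !(transpsimp HN) ?cm_opm1 => E.
mvgoal.
apply: (eq_of_eq (esym E)); zmod.
Qed.

Lemma symmetry_crossed : symmetry_law D <-> symmetry_cocycle.
Proof.
split=> H x y.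
  have := congr1 (@xh_val _ _ _ _) (H x y) => /= /(congr1 (transp N (x ⊙ y) cm_e)).
  rewrite !(transpsimp HN) ?cm_opm1 => E.
  rewrite -[LHS](transp_id HN) !(transpsimp HN) ?cm_opm1.
  apply: (eq_of_eq E); zmod.
have /(congr1 (transp N (x ⊙ y) cm_e)) := H x y.
rewrite !(transpsimp HN) ?cm_opm1 => E.
mvgoal.
apply: (eq_of_eq E); zmod.
Qed.

Lemma Z5_is_smag : Z5 g mu -> is_smag D.
Proof.
move=> [[_ [gx1z _]] [_ [Hp [Hh [_ Hs]]]]].
split; first exact: crossed_comp_assoc.
split; first exact: crossed_comp_id.
split; first exact: crossed_iso.
split; first exact: crossed_abelian.
split; first exact: crossed_tens_id.
split; first exact: crossed_tens_comp.
split; first exact: crossed_assoc_nat.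
split; first exact: crossed_lunit_nat.
split; first exact: crossed_runit_nat.
split; first exact: crossed_braid_nat.
split; first exact/pentagon_crossed.
(* The triangle is the vanishing of [g] when its middle argument is [cm_e]. *)
split; first by move=> x y; mvgoal; rewrite gx1z !(transpsimp HN); zmod.
split; first exact/hexagon_crossed.
exact/symmetry_crossed.
Qed.

(** Rewriting an argument of [g] changes the type of its value; under [transp] this is harmless. *)
Lemma transp_cochain3 w u x x' y y' z z' : x = x' -> y = y' -> z = z' ->
  transp N w u (g x y z) = transp N w u (g x' y' z').
Proof. by move=> -> -> ->. Qed.

(* The remaining normalizations are pentagons and hexagons with two arguments
   equal to e. *)
Lemma crossed_Z5 : pentagon D -> hexagon D -> symmetry_law D ->
  (forall x z, g x cm_e z = 0) -> Z5 g mu.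
Proof.
move=> /pentagon_crossed Hp /hexagon_crossed Hh /symmetry_crossed Hs gx1z.
have ge y z : g cm_e y z = 0.
  have := Hp cm_e cm_e y z => /(congr1 (transp N (cm_e ⊙ y ⊙ z) cm_e)).
  rewrite !(transpsimp HN) !gx1z !(transpsimp HN) ?(cm_opm1 cm_e).
  rewrite (transp_cochain3 _ _ erefl (cm_op1m y) erefl) => E.
  rewrite -[LHS](transp_id HN); apply: (eq_of_eq E); zmod.
have gex x y : g x y cm_e = 0.
  have := Hp x y cm_e cm_e => /(congr1 (transp N (x ⊙ y ⊙ cm_e) cm_e)).
  rewrite !(transpsimp HN) !gx1z !(transpsimp HN) ?(cm_opm1 cm_e).
  rewrite (transp_cochain3 _ _ erefl (cm_opm1 y) erefl) => E.
  rewrite -[LHS](transp_id HN); apply: (eq_of_eq E); zmod.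
have mue x : mu x cm_e = 0.
  have := Hh x cm_e cm_e => /(congr1 (transp N (x ⊙ cm_e) cm_e)).
  rewrite !gx1z ge !(transpsimp HN) ?(cm_opm1 cm_e) => E.
  rewrite -[LHS](transp_id HN); apply: (eq_of_eq E); zmod.
split; first by [].
split.
  split=> // y; have := Hs cm_e y; rewrite mue.
  by rewrite -[LHS](transp_id HN) !(transpsimp HN) addr0 !(transp_id HN).
split=> //; split=> //; split=> // x y z.
rewrite -[LHS](transp_id HN) !(transpsimp HN) ?cm_opm1.
have smu w a b u : transp N w u (mu a b) = - transp N w u (mu b a).
  by have /(congr1 (transp N w u)) := Hs a b; rewrite !(transpsimp HN) => /eqP;
    rewrite addr_eq0 => /eqP.
(* The second hexagon condition is minus the first one at [(z, x, y)], each [mu] being reversed by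
   antisymmetry. *)
have /(congr1 (transp N (x ⊙ y ⊙ z) cm_e)) := Hh z x y.
rewrite !(transpsimp HN) ?cm_opm1 (smu _ z y) (smu _ z (x ⊙ y)) (smu _ z x) => E.
apply: (eq_of_eq (esym E)); zmod.
Qed.

End Crossed.

(** * Fully faithful symmetric monoidal functors *)

Local Notation "f ∘ h" := (comp f h) (at level 50, left associativity).
Local Notation "f ⊗ h" := (tensm f h) (at level 40, left associativity).
Local Notation id_ := idm.

(** * Coherence in a symmetric monoidal abelian groupoid *)

Section SymmetricMonoidal.
Variable C : smag_data.
Hypothesis HC : is_smag C.
Implicit Types x y z w : C.

Lemma compA x y z w (f : hom x y) (g : hom y z) (h : hom z w) : h ∘ (g ∘ f) = h ∘ g ∘ f.
Proof. exact: HC.1. Qed.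

Lemma comp1m x y (f : hom x y) : id_ y ∘ f = f.
Proof. exact: (HC.2.1 _ _ f).1. Qed.

Lemma compm1 x y (f : hom x y) : f ∘ id_ x = f.
Proof. exact: (HC.2.1 _ _ f).2. Qed.

Lemma smag_iso x y (f : hom x y) : is_iso f.
Proof. by case: HC => _ [_ [H _]]; apply: H. Qed.

Definition inv x y (f : hom x y) : hom y x := sval (cid (smag_iso f)).

Lemma invK x y (f : hom x y) : inv f ∘ f = id_ x.
Proof. exact: (svalP (cid (smag_iso f))).1. Qed.

Lemma compV x y (f : hom x y) : f ∘ inv f = id_ y.
Proof. exact: (svalP (cid (smag_iso f))).2. Qed.

Lemma aut_comm x (f g : hom x x) : f ∘ g = g ∘ f.
Proof. by case: HC => _ [_ [_ [H _]]]; apply: H. Qed.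

Lemma tens_id x y : id_ x ⊗ id_ y = id_ (tens x y).
Proof. by case: HC => _ [_ [_ [_ [H _]]]]; apply: H. Qed.

Lemma tens_comp x x' x'' y y' y'' (f : hom x x') (f' : hom x' x'')
    (g : hom y y') (g' : hom y' y'') :
  (f' ∘ f) ⊗ (g' ∘ g) = f' ⊗ g' ∘ f ⊗ g.
Proof. by case: HC => _ [_ [_ [_ [_ [H _]]]]]; apply: H. Qed.

Lemma assoc_nat x x' y y' z z' (f : hom x x') (g : hom y y') (h : hom z z') :
  sassoc x' y' z' ∘ (f ⊗ g ⊗ h) = f ⊗ (g ⊗ h) ∘ sassoc x y z.
Proof. by case: HC => _ [_ [_ [_ [_ [_ [H _]]]]]]; apply: H. Qed.

Lemma lunit_nat x x' (f : hom x x') : lunit x' ∘ id_ tunit ⊗ f = f ∘ lunit x.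
Proof. by case: HC => _ [_ [_ [_ [_ [_ [_ [H _]]]]]]]; apply: H. Qed.

Lemma runit_nat x x' (f : hom x x') : runit x' ∘ f ⊗ id_ tunit = f ∘ runit x.
Proof. by case: HC => _ [_ [_ [_ [_ [_ [_ [_ [H _]]]]]]]]; apply: H. Qed.

Lemma braid_nat x x' y y' (f : hom x x') (g : hom y y') :
  braid x' y' ∘ f ⊗ g = g ⊗ f ∘ braid x y.
Proof. by case: HC => _ [_ [_ [_ [_ [_ [_ [_ [_ [H _]]]]]]]]]; apply: H. Qed.

Lemma smag_pentagon : pentagon C.
Proof. by case: HC => _ [_ [_ [_ [_ [_ [_ [_ [_ [_ [H _]]]]]]]]]]; apply: H. Qed.

Lemma smag_triangle x y : id_ x ⊗ lunit y ∘ sassoc x tunit y = runit x ⊗ id_ y.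
Proof. by case: HC => _ [_ [_ [_ [_ [_ [_ [_ [_ [_ [_ [H _]]]]]]]]]]]; apply: H. Qed.

Lemma smag_hexagon : hexagon C.
Proof. by case: HC => _ [_ [_ [_ [_ [_ [_ [_ [_ [_ [_ [_ [H _]]]]]]]]]]]]; apply: H. Qed.

Lemma smag_symmetry : symmetry_law C.
Proof. by case: HC => _ [_ [_ [_ [_ [_ [_ [_ [_ [_ [_ [_ [_ H]]]]]]]]]]]]; apply: H. Qed.

Lemma comp_canl x y z (h : hom y z) (f g : hom x y) : h ∘ f = h ∘ g -> f = g.
Proof. by move=> E; rewrite -[f]comp1m -[g]comp1m -(invK h) -!compA E. Qed.

Lemma comp_canr x y z (h : hom x y) (f g : hom y z) : f ∘ h = g ∘ h -> f = g.
Proof. by move=> E; rewrite -[f]compm1 -[g]compm1 -(compV h) !compA E. Qed.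

Lemma compVK x y z (h : hom y x) (f : hom y z) : f ∘ inv h ∘ h = f.
Proof. by rewrite -compA invK compm1. Qed.

Lemma compKl x y z (h : hom y z) (f : hom x y) : inv h ∘ (h ∘ f) = f.
Proof. by rewrite compA invK comp1m. Qed.

Lemma compVKl x y z (h : hom z y) (f : hom x y) : h ∘ (inv h ∘ f) = f.
Proof. by rewrite compA compV comp1m. Qed.

(** Lets an equation between composites be rewritten inside a right-nested chain. *)
Lemma precomp w x y z (f : hom y z) (g : hom x y) (h : hom x z) :
  f ∘ g = h -> forall k : hom w x, f ∘ (g ∘ k) = h ∘ k.
Proof. by move=> E k; rewrite compA E. Qed.

Lemma tens_compl x x' x'' y (f : hom x x') (f' : hom x' x'') :
  (f' ∘ f) ⊗ id_ y = f' ⊗ id_ y ∘ f ⊗ id_ y.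
Proof. by rewrite -tens_comp comp1m. Qed.

Lemma tens_compr x y y' y'' (f : hom y y') (f' : hom y' y'') :
  id_ x ⊗ (f' ∘ f) = id_ x ⊗ f' ∘ id_ x ⊗ f.
Proof. by rewrite -tens_comp comp1m. Qed.

Lemma tens_unit_injr x y (f g : hom x y) : f ⊗ id_ tunit = g ⊗ id_ tunit -> f = g.
Proof. by move=> E; apply: (comp_canr (h := runit x)); rewrite -!runit_nat E. Qed.

Lemma tens_unit_injl x y (f g : hom x y) : id_ tunit ⊗ f = id_ tunit ⊗ g -> f = g.
Proof. by move=> E; apply: (comp_canr (h := lunit x)); rewrite -!lunit_nat E. Qed.

(* Kelly: compare the two sides after tensoring with I on the left, where the
   pentagon and two triangles apply. *)
Lemma lunit_tens x y : lunit (tens x y) ∘ sassoc tunit x y = lunit x ⊗ id_ y.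
Proof.
apply: tens_unit_injl.
apply: (comp_canr (h := sassoc tunit (tens tunit x) y ∘ sassoc tunit tunit x ⊗ id_ y)).
rewrite tens_compr -compA smag_pentagon compA smag_triangle -tens_id.
rewrite -assoc_nat -smag_triangle tens_compl.
by rewrite [RHS]compA -[_ ⊗ (_ ⊗ _) ∘ sassoc _ _ _]assoc_nat -compA.
Qed.

(** After tensoring with I, the triangle and [lunit_tens] reduce this to [lunit (tens tunit tunit) =
    id_ tunit ⊗ lunit tunit], which is naturality of [lunit] at itself. *)
Lemma lunit_runit_unit : lunit tunit = runit tunit :> hom (tens tunit tunit) (tunit : C).
Proof.
apply: tens_unit_injr; rewrite -smag_triangle -lunit_tens; congr (_ ∘ _).
by apply: (comp_canl (h := lunit tunit)); rewrite lunit_nat.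
Qed.

(* In an abelian groupoid conjugation Aut x -> Aut y does not depend on the
   isomorphism x -> y. *)
Lemma conj_indep x y (u v : hom x y) (a : hom x x) (b : hom y y) :
  u ∘ a = b ∘ u -> v ∘ a = b ∘ v.
Proof.
move=> E; rewrite -[v in LHS](compVK u) -compA E compA (aut_comm _ b).
by rewrite -compA compVK.
Qed.

End SymmetricMonoidal.

(** * Axioms reflected by a faithful functor, and its quasi-inverse *)

Section FaithfulFunctor.
Variables (D C : smag_data) (F : smfun D C).
Hypotheses (HC : is_smag C) (HF : is_smfun F).
Hypothesis F_inj : forall (x y : D) (f h : hom x y), fhom F f = fhom F h -> f = h.
Implicit Types x y z w : D.

Local Notation φ := (fphi F).

Lemma fun_id x : fhom F (id_ x) = id_ (fob F x).
Proof. exact: HF.1. Qed.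

Lemma fun_comp x y z (f : hom x y) (h : hom y z) : fhom F (h ∘ f) = fhom F h ∘ fhom F f.
Proof. exact: HF.2.1. Qed.

Lemma fun_nat x x' y y' (f : hom x x') (h : hom y y') :
  fhom F (f ⊗ h) ∘ φ x y = φ x' y' ∘ fhom F f ⊗ fhom F h.
Proof. by case: HF => _ [_ [_ [_ [H _]]]]; apply: H. Qed.

Lemma fun_assoc x y z :
  fhom F (sassoc x y z) ∘ (φ (tens x y) z ∘ φ x y ⊗ id_ (fob F z))
  = φ x (tens y z) ∘ (id_ (fob F x) ⊗ φ y z ∘ sassoc (fob F x) (fob F y) (fob F z)).
Proof. by case: HF => _ [_ [_ [_ [_ [H _]]]]]; apply: H. Qed.

Lemma fun_lunit x :
  fhom F (lunit x) ∘ (φ tunit x ∘ fphi0 F ⊗ id_ (fob F x)) = lunit (fob F x).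
Proof. by case: HF => _ [_ [_ [_ [_ [_ [H _]]]]]]; apply: H. Qed.

Lemma fun_runit x :
  fhom F (runit x) ∘ (φ x tunit ∘ id_ (fob F x) ⊗ fphi0 F) = runit (fob F x).
Proof. by case: HF => _ [_ [_ [_ [_ [_ [_ [H _]]]]]]]; apply: H. Qed.

Lemma fun_braid x y : fhom F (braid x y) ∘ φ x y = φ y x ∘ braid (fob F x) (fob F y).
Proof. by case: HF => _ [_ [_ [_ [_ [_ [_ [_ H]]]]]]]; apply: H. Qed.

Lemma fun_assoc' v x y z (k : hom v _) :
  fhom F (sassoc x y z) ∘ (φ (tens x y) z ∘ (φ x y ⊗ id_ (fob F z) ∘ k))
  = φ x (tens y z) ∘ (id_ (fob F x) ⊗ φ y z ∘ (sassoc (fob F x) (fob F y) (fob F z) ∘ k)).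
Proof. by rewrite !(compA HC) -[_ ∘ φ x y ⊗ _](compA HC) fun_assoc !(compA HC). Qed.

(** Under [F], the tensor constraints can be pulled to the left of both sides; what remains on the
    right is the pentagon of [C]. *)
Lemma faithful_pentagon : pentagon D.
Proof.
move=> w x y z; apply: F_inj.
apply: (@comp_canr _ HC _ _ _ (φ (tens (tens w x) y) z ∘
  (φ (tens w x) y ⊗ id_ _ ∘ φ w x ⊗ id_ _ ⊗ id_ _))).
rewrite !fun_comp -!(compA HC) (precomp HC (fun_nat _ _)) -!(compA HC) fun_id.
rewrite -!(tens_compl HC) fun_assoc !(tens_compl HC) fun_assoc'.
rewrite (precomp HC (assoc_nat HC _ _ _)) -!(compA HC) (precomp HC (fun_nat _ _)).
rewrite fun_id -!(compA HC) (precomp HC (esym (tens_compr HC _ _ _))).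
rewrite (precomp HC (esym (tens_compr HC _ _ _))) -!(compA HC) fun_assoc.
rewrite !(tens_compr HC) -!(compA HC) (smag_pentagon HC).
rewrite fun_assoc' (assoc_nat HC) (tens_id HC).
(* Interchange: [φ w x] and [φ y z] act on disjoint factors, so they are swapped to let [fun_assoc']
   apply once more. *)
rewrite [in RHS](precomp HC (esym (tens_comp HC _ _ _ _))) (comp1m HC) (compm1 HC).
rewrite -[φ w x in RHS](compm1 HC) -[φ y z in RHS](comp1m HC) (tens_comp HC).
rewrite -!(compA HC) fun_assoc' -(tens_id HC) (precomp HC (assoc_nat HC _ _ _)).
by rewrite -!(compA HC).
Qed.

Lemma faithful_hexagon : hexagon D.
Proof.
move=> x y z; apply: F_inj.
apply: (@comp_canr _ HC _ _ _ (φ (tens x y) z ∘ φ x y ⊗ id_ _)).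
rewrite !fun_comp -!(compA HC) fun_assoc (precomp HC (fun_braid _ _)) -!(compA HC).
rewrite (precomp HC (braid_nat HC _ _)) -!(compA HC) fun_assoc' (smag_hexagon HC).
rewrite (precomp HC (fun_nat _ _)) fun_id -!(compA HC) -(tens_compl HC) fun_braid.
rewrite (tens_compl HC) fun_assoc' (precomp HC (fun_nat _ _)) fun_id -!(compA HC).
rewrite [in RHS](precomp HC (esym (tens_compr HC _ _ _))) fun_braid (tens_compr HC).
by rewrite -!(compA HC).
Qed.

Lemma faithful_symmetry : symmetry_law D.
Proof.
move=> x y; apply: F_inj; apply: (@comp_canr _ HC _ _ _ (φ x y)).
rewrite fun_comp fun_id -(compA HC) fun_braid (precomp HC (fun_braid _ _)) -(compA HC).
by rewrite (smag_symmetry HC) (comp1m HC) (compm1 HC).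
Qed.

Hypothesis F_full : forall (x y : D) (h : hom (fob F x) (fob F y)), exists f, fhom F f = h.
Hypothesis F_surj : forall c : C, exists d : D, inhabited (hom (fob F d) c).

Definition lift_hom x y (h : hom (fob F x) (fob F y)) : hom x y := sval (cid (F_full h)).

Lemma lift_homK x y (h : hom (fob F x) (fob F y)) : fhom F (lift_hom h) = h.
Proof. exact: (svalP (cid (F_full h))). Qed.

Definition quasi_ob (c : C) : D := sval (cid (F_surj c)).

(** Choice needs an existential, so the [inhabited] proof is repackaged with a trivially true
    predicate. *)
Definition counit (c : C) : hom (fob F (quasi_ob c)) c :=
  sval (cid (let: inhabits e := svalP (cid (F_surj c)) in ex_intro (fun=> True) e I)).

Local Notation ε := counit.

(* The structure of the quasi-inverse is the one that makes ε monoidal. *)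
Definition quasi_inverse : smfun C D :=
  @SMFun C D quasi_ob
    (fun (x y : C) f => lift_hom (inv HC (ε y) ∘ (f ∘ ε x)))
    (fun (x y : C) => lift_hom (inv HC (ε (tens x y)) ∘
      (ε x ⊗ ε y ∘ inv HC (φ (quasi_ob x) (quasi_ob y)))))
    (lift_hom (inv HC (ε tunit) ∘ inv HC (fphi0 F))).

Local Notation G := quasi_inverse.

Lemma counit_hom (x y : C) (f : hom x y) : ε y ∘ fhom F (fhom G f) = f ∘ ε x.
Proof. by rewrite lift_homK compVKl. Qed.

Lemma counit_phi (x y : C) :
  ε (tens x y) ∘ (fhom F (fphi G x y) ∘ φ (fob G x) (fob G y)) = ε x ⊗ ε y.
Proof. by rewrite lift_homK -!(compA HC) invK (compm1 HC) compVKl. Qed.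

Lemma counit_phi0 : ε tunit ∘ (fhom F (fphi0 G) ∘ fphi0 F) = id_ tunit.
Proof. by rewrite lift_homK -!(compA HC) invK (compm1 HC) compV. Qed.

Lemma counit_phi' (v : C) (x y : C) (k : hom v _) :
  ε (tens x y) ∘ (fhom F (fphi G x y) ∘ (φ (fob G x) (fob G y) ∘ k)) = ε x ⊗ ε y ∘ k.
Proof. by rewrite -counit_phi -!(compA HC). Qed.

(** Only [C] is assumed to be a groupoid here; invertibility in [D] is reflected along [F]. *)
Lemma full_iso x y (f : hom x y) : is_iso f.
Proof.
exists (lift_hom (inv HC (fhom F f))); split; apply: F_inj;
  by rewrite fun_comp fun_id lift_homK ?invK ?compV.
Qed.

(** Each axiom is checked after applying [F], between [ε] on the left and constraints of [F] on the
    right; the [counit] lemmas reduce it to naturality in [C] and the axiom for [F]. *)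
Lemma quasi_inverse_smfun : is_smfun G.
Proof.
split; first by move=> x; apply: F_inj; rewrite lift_homK (comp1m HC) invK fun_id.
split.
  move=> x y z f h; apply: F_inj; apply: (comp_canl HC (h := ε z)).
  by rewrite fun_comp counit_hom (precomp HC (counit_hom _)) -!(compA HC) counit_hom.
split; first by move=> x y; apply: full_iso.
split; first exact: full_iso.
split.
  move=> x x' y y' f h; apply: F_inj; apply: (comp_canl HC (h := ε _)).
  apply: (@comp_canr _ HC _ _ _ (φ _ _)).
  rewrite !fun_comp -!(compA HC) (precomp HC (counit_hom _)) -(compA HC) counit_phi.
  by rewrite fun_nat counit_phi' -!(tens_comp HC) !counit_hom.
split.
  move=> x y z; apply: F_inj; apply: (comp_canl HC (h := ε _)).
  apply: (@comp_canr _ HC _ _ _ (φ _ _ ∘ φ _ _ ⊗ id_ _)).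
  rewrite !fun_comp -!(compA HC) (precomp HC (counit_hom _)) -(compA HC).
  rewrite (precomp HC (fun_nat _ _)) fun_id -!(compA HC) counit_phi' -!(tens_comp HC).
  rewrite !(comp1m HC) counit_phi (compm1 HC) (assoc_nat HC).
  rewrite fun_assoc (precomp HC (fun_nat _ _)) fun_id -!(compA HC) counit_phi'.
  by rewrite !(precomp HC (esym (tens_comp HC _ _ _ _))) -?(compA HC) !(compm1 HC) counit_phi.
split.
  move=> x; apply: F_inj; apply: (comp_canl HC (h := ε _)).
  apply: (@comp_canr _ HC _ _ _ (φ _ _ ∘ fphi0 F ⊗ id_ _)).
  rewrite !fun_comp -!(compA HC) (precomp HC (counit_hom _)) -(compA HC).
  rewrite (precomp HC (fun_nat _ _)) fun_id -!(compA HC) counit_phi' -!(tens_comp HC).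
  by rewrite !(compm1 HC) counit_phi0 (lunit_nat HC) fun_lunit.
split.
  move=> x; apply: F_inj; apply: (comp_canl HC (h := ε _)).
  apply: (@comp_canr _ HC _ _ _ (φ _ _ ∘ id_ _ ⊗ fphi0 F)).
  rewrite !fun_comp -!(compA HC) (precomp HC (counit_hom _)) -(compA HC).
  rewrite (precomp HC (fun_nat _ _)) fun_id -!(compA HC) counit_phi' -!(tens_comp HC).
  by rewrite !(compm1 HC) counit_phi0 (runit_nat HC) fun_runit.
move=> x y; apply: F_inj; apply: (comp_canl HC (h := ε _)).
apply: (@comp_canr _ HC _ _ _ (φ _ _)).
rewrite !fun_comp -!(compA HC) (precomp HC (counit_hom _)) -(compA HC) counit_phi.
by rewrite fun_braid counit_phi' (braid_nat HC).
Qed.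

Lemma ff_es_equiv : sm_equiv D C.
Proof.
exists F, G; split=> //; split; first exact: quasi_inverse_smfun.
split.
  (* The transformation from GF to the identity is the preimage under [F] of [ε] at [fob F x]. *)
  exists (fun x => lift_hom (ε (fob F x))).
  split; first by move=> x; apply: full_iso.
  split; first by move=> x y f; apply: F_inj; rewrite !fun_comp !(lift_homK (ε _)) counit_hom.
  split.
    move=> x y; apply: F_inj; apply: (@comp_canr _ HC _ _ _ (φ _ _)).
    rewrite !fun_comp lift_homK -!(compA HC) (precomp HC (counit_hom _)) -(compA HC) counit_phi.
    by rewrite fun_nat fun_id (comp1m HC) !lift_homK.
  apply: F_inj; apply: (@comp_canr _ HC _ _ _ (fphi0 F)).
  rewrite !fun_comp lift_homK -!(compA HC) (precomp HC (counit_hom _)) -(compA HC) counit_phi0.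
  by rewrite (compm1 HC) fun_id (comp1m HC).
exists ε; split; first by move=> x; apply: smag_iso.
split; first by move=> x y f; apply: counit_hom.
split; first by move=> x y; rewrite (comp1m HC); apply: counit_phi.
exact: counit_phi0.
Qed.

End FaithfulFunctor.

(** * Skeletons *)

(** A copy of [hom x x] that carries [HC], because the group instance attached to it needs the
    groupoid axioms. *)
Definition aut (C : smag_data) (HC : is_smag C) (x : C) : Type := hom x x.

Section Aut.
Variables (C : smag_data) (HC : is_smag C) (x : C).
Local Notation A := (aut HC x).

Lemma aut_addA : associative (fun a b : A => a ∘ b : A).
Proof. by move=> a b c; rewrite (compA HC). Qed.

Lemma aut_addC : commutative (fun a b : A => a ∘ b : A).
Proof. by move=> a b; rewrite (aut_comm HC). Qed.

Lemma aut_add0 : left_id (id_ x : A) (fun a b : A => a ∘ b : A).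
Proof. by move=> a; rewrite (comp1m HC). Qed.

Lemma aut_addN : left_inverse (id_ x : A) (fun a : A => inv HC a : A) (fun a b : A => a ∘ b : A).
Proof. by move=> a; rewrite (invK HC). Qed.

HB.instance Definition _ := gen_eqMixin A.
HB.instance Definition _ := gen_choiceMixin A.
HB.instance Definition _ := GRing.isZmodule.Build A aut_addA aut_addC aut_add0 aut_addN.

Lemma aut_addE (a b : A) : a + b = a ∘ b.
Proof. by []. Qed.
End Aut.

(** * The crossed product of a skeleton *)

Section SkeletalSection.
Variables (C : smag_data) (HC : is_smag C) (M : comMonoid) (s : M -> C).
Variable ι : hom tunit (s cm_e).
Implicit Types x y z : M.

Definition obcast x y (p : x = y) : hom (s x) (s y) :=
  match p in _ = z return hom (s x) (s z) with erefl => id_ (s x) end.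

Lemma obcast_id x (p : x = x) : obcast p = id_ (s x).
Proof. by rewrite (Prop_irrelevance p erefl). Qed.

Lemma obcast_comp x y z (p : x = y) (q : y = z) (r : x = z) : obcast q ∘ obcast p = obcast r.
Proof.
case: z / q r => r; case: y / p r => r.
by rewrite !obcast_id (comp1m HC).
Qed.

Lemma normalized_tensor : (forall x y, inhabited (hom (tens (s x) (s y)) (s (x ⊙ y)))) ->
  exists φ : forall x y, hom (tens (s x) (s y)) (s (x ⊙ y)),
    (forall y, obcast (cm_op1m y) ∘ (φ cm_e y ∘ ι ⊗ id_ (s y)) = lunit (s y)) /\
    (forall x, obcast (cm_opm1 x) ∘ (φ x cm_e ∘ id_ (s x) ⊗ ι) = runit (s x)).
Proof.
move=> H.
(* Quantifying over proofs that an argument is [cm_e] lets [φ x y] be chosen separately for each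
   pair. *)
have {}H x y : exists f : hom (tens (s x) (s y)) (s (x ⊙ y)),
    (forall (p : cm_e = x) (q : x ⊙ y = y),
        obcast q ∘ (f ∘ (obcast p ∘ ι) ⊗ id_ (s y)) = lunit (s y)) /\
    (forall (p : cm_e = y) (q : x ⊙ y = x),
        obcast q ∘ (f ∘ id_ (s x) ⊗ (obcast p ∘ ι)) = runit (s x)).
  case: (pselect (cm_e = x)) => [ex|nex].
    case: x / ex.
    exists (obcast (esym (cm_op1m y)) ∘ (lunit (s y) ∘ inv HC (ι ⊗ id_ (s y)))); split.
      move=> p q; rewrite obcast_id (comp1m HC) -!(compA HC) invK (compm1 HC) (compA HC).
      by rewrite (obcast_comp _ _ erefl) (comp1m HC).
    move=> p; case: y / p => q; rewrite obcast_id (comp1m HC) -!(compA HC) (compA HC).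
    rewrite (obcast_comp _ _ erefl) (comp1m HC).
    (* Here both arguments are [cm_e] and both normalizations must hold; naturality along [ι]
       reduces this to [lunit_runit_unit]. *)
    apply: (@comp_canr _ HC _ _ _ (ι ⊗ id_ tunit)).
    rewrite (runit_nat HC) -(lunit_runit_unit HC) -(lunit_nat HC) -!(compA HC); congr (_ ∘ _).
    apply: (@comp_canl _ HC _ _ _ (ι ⊗ id_ _)).
    by rewrite compVKl -!(tens_comp HC) !(comp1m HC) !(compm1 HC).
  case: (pselect (cm_e = y)) => [ey|ney].
    case: y / ey.
    exists (obcast (esym (cm_opm1 x)) ∘ (runit (s x) ∘ inv HC (id_ (s x) ⊗ ι))); split => // p q.
    rewrite obcast_id (comp1m HC) -!(compA HC) invK (compm1 HC) (compA HC).
    by rewrite (obcast_comp _ _ erefl) (comp1m HC).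
  by case: (H x y) => f; exists f.
exists (fun x y => sval (cid (H x y))); split=> x.
  by case: (cid (H cm_e x)) => f /= [/(_ erefl (cm_op1m x)) + _]; rewrite (comp1m HC).
by case: (cid (H x cm_e)) => f /= [_ /(_ erefl (cm_opm1 x))]; rewrite (comp1m HC).
Qed.

Variable φ : forall x y, hom (tens (s x) (s y)) (s (x ⊙ y)).
Hypothesis φ_lunit : forall y, obcast (cm_op1m y) ∘ (φ cm_e y ∘ ι ⊗ id_ (s y)) = lunit (s y).
Hypothesis φ_runit : forall x, obcast (cm_opm1 x) ∘ (φ x cm_e ∘ id_ (s x) ⊗ ι) = runit (s x).

Definition aut_module : hmod M :=
  @HMod M (fun x => aut HC (s x))
    (fun x y a => φ x y ∘ (a ⊗ id_ (s y) ∘ inv HC (φ x y))).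
Local Notation N := aut_module.

Lemma aut_act x y (a : N x) : (hm_act N x y a : hom _ _) ∘ φ x y = φ x y ∘ a ⊗ id_ (s y).
Proof. by rewrite /= -!(compA HC) invK (compm1 HC). Qed.

Lemma aut_cast x y (p : x = y) (a : N x) : obcast p ∘ a = hcast N p a ∘ obcast p.
Proof. by case: y / p => /=; rewrite (comp1m HC) (compm1 HC). Qed.

Lemma aut_module_ok : is_hmod N.
Proof.
split; [|split].
- move=> x y a b; apply: (@comp_canr _ HC _ _ _ (φ x y)).
  rewrite aut_act !aut_addE -(compA HC) !aut_act (tens_compl HC).
  by rewrite [RHS](compA HC) aut_act (compA HC).
- move=> x a; apply: (@comp_canr _ HC _ _ _ (runit (s x))).
  rewrite -[in LHS]φ_runit (compA HC) -aut_cast -(runit_nat HC) -φ_runit -!(compA HC).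
  congr (_ ∘ _).
  by rewrite (compKl HC) -!(tens_comp HC) !(comp1m HC) !(compm1 HC).
move=> x y z a.
apply: (@comp_canr _ HC _ _ _ (φ (x ⊙ y) z ∘ φ x y ⊗ id_ (s z))).
rewrite (compA HC) aut_act -(compA HC) -(tens_compl HC) aut_act (tens_compl HC) (compA HC).
(* The two bracketings give two arrows into [s (x ⊙ y ⊙ z)]; conjugation may be computed along the
   one through the associator. *)
apply: (conj_indep HC (u := obcast (cm_opA x y z) ∘
  (φ x (y ⊙ z) ∘ (id_ (s x) ⊗ φ y z ∘ sassoc (s x) (s y) (s z))))).
rewrite [RHS](compA HC) -aut_cast -!(compA HC); congr (_ ∘ _).
rewrite (compKl HC) (assoc_nat HC) (tens_id HC); congr (_ ∘ _).
by rewrite !(compA HC) -!(tens_comp HC) !(comp1m HC) !(compm1 HC).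
Qed.

(** The value that makes the associativity square of [skel_fun] commute; [obcast] returns it to an
    automorphism of [s (x ⊙ y ⊙ z)]. *)
Definition skel_assoc : cochain3 N := fun x y z =>
  obcast (cm_opA x y z) ∘ (φ x (y ⊙ z) ∘ (id_ (s x) ⊗ φ y z ∘ (sassoc (s x) (s y) (s z) ∘
    inv HC (φ (x ⊙ y) z ∘ φ x y ⊗ id_ (s z))))).

Definition skel_braid : cochain2 N := fun x y =>
  obcast (cm_opC y x) ∘ (φ y x ∘ (braid (s x) (s y) ∘ inv HC (φ x y))).

Local Notation D := (crossed skel_assoc skel_braid).

Definition skel_fun : smfun D C :=
  @SMFun D C s (fun x y (f : @xhom M N x y) => (xh_val f : hom _ _) ∘ obcast (xh_eq f)) φ ι.

(** The action is defined through the left factor; the braiding carries it to the right one, and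
    [conj_indep] ignores the detour. *)
Lemma aut_actr x y (b : N y) :
  (hcast N (cm_opC y x) (hm_act N y x b) : hom _ _) ∘ φ x y = φ x y ∘ id_ (s x) ⊗ b.
Proof.
apply: esym.
apply: (conj_indep HC (u := obcast (cm_opC y x) ∘ (φ y x ∘ braid (s x) (s y)))).
rewrite [RHS](compA HC) -aut_cast -!(compA HC) (braid_nat HC).
by rewrite (compKl HC).
Qed.

Lemma skel_fun_smfun : is_smfun skel_fun.
Proof.
split; first by move=> x /=; rewrite (comp1m HC).
split.
  move=> x y z [p a] [q b]; case: z / q b => b; case: y / p a b => a b /=.
  (* Sums and composites list the two values in opposite orders; automorphisms commute. *)
  by rewrite !(compm1 HC) aut_addE (aut_comm HC).
split; first by move=> x y; apply: smag_iso.
split; first exact: smag_iso.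
split.
  move=> x x' y y' [p a] [q b]; case: x' / p a => a; case: y' / q b => b.
  rewrite /fhom /= obcast_id !(compm1 HC) aut_addE -(compA HC) aut_actr.
  rewrite [LHS](compA HC) aut_act -(compA HC) -(tens_comp HC) (comp1m HC) (compm1 HC).
  by [].
split.
  move=> x y z; rewrite /fhom /= -aut_cast /skel_assoc !(compA HC) (obcast_comp _ _ erefl).
  by rewrite (comp1m HC) -!(compA HC) invK (compm1 HC).
split; first by move=> x; rewrite /fhom /= (comp1m HC) φ_lunit.
split; first by move=> x; rewrite /fhom /= (comp1m HC) φ_runit.
move=> x y; rewrite /fhom /= -aut_cast /skel_braid !(compA HC) (obcast_comp _ _ erefl).
by rewrite (comp1m HC) -!(compA HC) invK (compm1 HC).
Qed.

Lemma skel_fun_inj (x y : D) (f h : hom x y) : fhom skel_fun f = fhom skel_fun h -> f = h.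
Proof.
case: f h => p a [q b] /= E; apply: xhom_eq => /=.
by move: E; rewrite (Prop_irrelevance q p); apply: comp_canr.
Qed.

Lemma φ_obcast x y z (p : y = z) (q : x ⊙ y = x ⊙ z) :
  φ x z ∘ id_ (s x) ⊗ obcast p = obcast q ∘ φ x y.
Proof. by case: z / p q => q; rewrite !obcast_id (comp1m HC) (tens_id HC) (compm1 HC). Qed.

Lemma φ_obcastl x y z (p : x = z) (q : x ⊙ y = z ⊙ y) :
  φ z y ∘ obcast p ⊗ id_ (s y) = obcast q ∘ φ x y.
Proof. by case: z / p q => q; rewrite !obcast_id (comp1m HC) (tens_id HC) (compm1 HC). Qed.

(** Precomposed with [ι] in the middle factor, the normalized [φ] become unit constraints and the
    claim is the triangle axiom. *)
Lemma skel_assoc_unit x z : skel_assoc x cm_e z = 0.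
Proof.
set p := cm_opA x cm_e z.
suff E : obcast p ∘ (φ x (cm_e ⊙ z) ∘ (id_ (s x) ⊗ φ cm_e z ∘ sassoc (s x) (s cm_e) (s z)))
    = φ (x ⊙ cm_e) z ∘ φ x cm_e ⊗ id_ (s z).
  have := congr1 (fun k => k ∘ inv HC (φ (x ⊙ cm_e) z ∘ φ x cm_e ⊗ id_ (s z))) E.
  by rewrite (compV HC) -!(compA HC).
have q : x ⊙ cm_e ⊙ z = x ⊙ z by rewrite cm_opm1.
have q' : x ⊙ (cm_e ⊙ z) = x ⊙ z by rewrite cm_op1m.
apply: (@comp_canl _ HC _ _ _ (obcast q)).
apply: (@comp_canr _ HC _ _ _ (id_ (s x) ⊗ ι ⊗ id_ (s z))).
rewrite [obcast q ∘ (obcast p ∘ _)](compA HC) (obcast_comp _ _ q').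
rewrite [in RHS](compA HC) -(φ_obcastl (cm_opm1 x)) -!(compA HC) (assoc_nat HC).
rewrite -!(tens_compl HC) φ_runit.
rewrite (compA HC) -(φ_obcast (cm_op1m z)) -(smag_triangle HC) -φ_lunit -!(compA HC).
by rewrite !(tens_compr HC) -!(compA HC).
Qed.

Hypothesis s_inj : forall x y, inhabited (hom (s x) (s y)) -> x = y.
Hypothesis s_surj : forall c : C, exists x, inhabited (hom (s x) c).

Lemma skel_fun_full (x y : D) (h : hom (fob skel_fun x) (fob skel_fun y)) :
  exists f : hom x y, fhom skel_fun f = h.
Proof.
have p := s_inj (inhabits h).
exists (XHom p (h ∘ inv HC (obcast p) : N y)).
by rewrite /= (compVK HC).
Qed.

Lemma skel_Z5 : Z5 skel_assoc skel_braid.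
Proof.
apply: (crossed_Z5 aut_module_ok).
- exact: faithful_pentagon HC skel_fun_smfun skel_fun_inj.
- exact: faithful_hexagon HC skel_fun_smfun skel_fun_inj.
- exact: faithful_symmetry HC skel_fun_smfun skel_fun_inj.
- exact: skel_assoc_unit.
Qed.

Lemma skel_equiv : sm_equiv D C.
Proof. exact: ff_es_equiv HC skel_fun_smfun skel_fun_inj skel_fun_full s_surj. Qed.

End SkeletalSection.

(** Choice depends only on the predicate; this makes [rep] constant on isomorphism classes. *)
Lemma sval_cid_eq (T : Type) (P Q : T -> Prop) (hP : exists x, P x) (hQ : exists x, Q x) :
  P = Q -> sval (cid hP) = sval (cid hQ).
Proof. by move=> E; case: Q / E hQ => hQ; rewrite (Prop_irrelevance hP hQ). Qed.

(** * The monoid of isomorphism classes *)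

Section IsoClasses.
Variables (C : smag_data) (HC : is_smag C).
Implicit Types x y z : C.

Definition isomorphic x y : Prop := inhabited (hom x y).

Lemma isomorphic_refl x : isomorphic x x.
Proof. by split; apply: idm. Qed.

Lemma isomorphic_sym x y : isomorphic x y -> isomorphic y x.
Proof. by case=> f; split; apply: inv HC _ _ f. Qed.

Lemma isomorphic_trans x y z : isomorphic x y -> isomorphic y z -> isomorphic x z.
Proof. by case=> f [h]; split; exact: (h ∘ f). Qed.

Lemma isomorphic_tens x x' y y' : isomorphic x x' -> isomorphic y y' ->
  isomorphic (tens x y) (tens x' y').
Proof. by case=> f [h]; split; exact: (f ⊗ h). Qed.

Definition rep x : C := sval (cid (ex_intro (isomorphic x) x (isomorphic_refl x))).

Lemma rep_iso x : isomorphic x (rep x).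
Proof. exact: (svalP (cid (ex_intro (isomorphic x) x (isomorphic_refl x)))). Qed.

Lemma rep_eq x y : isomorphic x y -> rep x = rep y.
Proof.
move=> xy; apply: sval_cid_eq; apply/funext => z; apply/propext.
by split; apply: isomorphic_trans => //; apply: isomorphic_sym.
Qed.

(** The quotient is encoded by the fixed points of [rep], so that [sval] is directly the inclusion
    of a skeleton. *)
Definition iso_class : Type := {x : C | rep x = x}.

Lemma rep_idem x : rep (rep x) = rep x.
Proof. exact/rep_eq/isomorphic_sym/rep_iso. Qed.

Definition class_of x : iso_class := exist _ (rep x) (rep_idem x).

Lemma iso_class_eq (a b : iso_class) : isomorphic (sval a) (sval b) -> a = b.
Proof.
case: a b => x p [y q] /= /rep_eq; rewrite p q => E; case: y / E q => q.
by rewrite (Prop_irrelevance p q).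
Qed.

Definition class_tens (a b : iso_class) : iso_class := class_of (tens (sval a) (sval b)).

Lemma class_tens_iso a b : isomorphic (tens (sval a) (sval b)) (sval (class_tens a b)).
Proof. exact: rep_iso. Qed.

Lemma class_tensA : associative class_tens.
Proof.
move=> a b c; apply: iso_class_eq.
apply: isomorphic_trans (isomorphic_sym (class_tens_iso _ _)) _.
apply: isomorphic_trans (class_tens_iso _ _).
apply: isomorphic_trans (isomorphic_tens (isomorphic_refl _)
  (isomorphic_sym (class_tens_iso _ _))) _.
apply: isomorphic_trans (isomorphic_tens (class_tens_iso _ _) (isomorphic_refl _)).
by apply: isomorphic_sym; split; apply: sassoc.
Qed.

Lemma class_tensC : commutative class_tens.
Proof.
move=> a b; apply: iso_class_eq.
apply: isomorphic_trans (isomorphic_sym (class_tens_iso _ _)) _.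
apply: isomorphic_trans (class_tens_iso _ _).
by split; apply: braid.
Qed.

Lemma class_tens1m : left_id (class_of tunit) class_tens.
Proof.
move=> a; apply: iso_class_eq.
apply: isomorphic_trans (isomorphic_sym (class_tens_iso _ _)) _.
apply: isomorphic_trans (isomorphic_tens (isomorphic_sym (rep_iso _)) (isomorphic_refl _)) _.
by split; apply: lunit.
Qed.

Definition iso_class_monoid : comMonoid := ComMonoid class_tensA class_tensC class_tens1m.

Lemma smag_crossed_equiv :
  exists (M : comMonoid) (N : hmod M) (g : cochain3 N) (mu : cochain2 N),
    is_hmod N /\ Z5 g mu /\ sm_equiv (crossed g mu) C.
Proof.
case: (rep_iso tunit) => ι.
have [φ [Hl Hr]] := @normalized_tensor C HC iso_class_monoid (@sval _ _) ι class_tens_iso.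
exists iso_class_monoid, (aut_module HC φ), (skel_assoc HC φ), (skel_braid HC φ).
split; first exact: aut_module_ok Hr.
split; first exact: skel_Z5 Hl Hr.
apply: skel_equiv Hl Hr _ _; first exact: iso_class_eq.
by move=> c; exists (class_of c); apply/isomorphic_sym/rep_iso.
Qed.

End IsoClasses.

(** * Classification of equivalences *)

Lemma hcast0 (M : comMonoid) (N : hmod M) (x y : M) (p : x = y) :
  hcast N p (0 : N x) = 0.
Proof. by case: y / p. Qed.

(** The premise rules out the junk value in the inner transport. *)
Lemma transp_transp (M : comMonoid) (N : hmod M) (HN : is_hmod N) (w u w' u' x : M) (a : N x) :
  x ⊙ u' = w' -> transp N w u (transp N w' u' a) = transp N w (u' ⊙ u) a.
Proof. by move=> p; rewrite (transpE p) transp_cast (transp_act HN). Qed.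

Lemma transp_congr (M : comMonoid) (N : hmod M) (w u v x : M) (a : N x) :
  u = v -> transp N w u a = transp N w v a.
Proof. by move=> ->. Qed.

(** * Transport through a module map *)

Section ModuleMap.
Variables (M M' : comMonoid) (N : hmod M) (N' : hmod M') (i : cmhom M M').
Hypothesis HN' : is_hmod N'.
Variable psi : forall x, N x -> N' (i x).
Hypothesis psiD : forall x (a b : N x), psi (a + b) = psi a + psi b.
Hypothesis psi_act : forall x y (a : N x),
  psi (hm_act N x y a) = hcast N' (esym (cmh_mul i x y)) (hm_act N' (i x) (i y) (psi a)).
Implicit Types x y : M.

Lemma map0 x : psi (0 : N x) = 0.
Proof. by apply: (addIr (psi (0 : N x))); rewrite -psiD !add0r. Qed.

Lemma mapN x (a : N x) : psi (- a) = - psi a.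
Proof. by apply/eqP; rewrite -addr_eq0 -psiD addNr map0. Qed.

Lemma transp_map_cast w u x y (p : x = y) (a : N x) :
  transp N' w u (psi (hcast N p a)) = transp N' w u (psi a).
Proof. by case: y / p. Qed.

Lemma transp_map_act w u x y (a : N x) :
  transp N' w u (psi (hm_act N x y a)) = transp N' w (i y ⊙ u) (psi a).
Proof. by rewrite psi_act transp_cast (transp_act HN'). Qed.

Definition mapsimp := (transp_map_cast, transp_map_act, psiD, mapN, map0, transpsimp HN').
End ModuleMap.

(** * From cohomologous cocycles to an equivalence *)

Section InducedEquivalence.
Variables (M M' : comMonoid) (N : hmod M) (N' : hmod M').
Variables (g : cochain3 N) (mu : cochain2 N) (g' : cochain3 N') (mu' : cochain2 N').
Hypotheses (HN : is_hmod N) (HN' : is_hmod N') (Zg' : Z5 g' mu').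
Variables (i : cmhom M M') (psi : forall x, N x -> N' (i x)) (psiinv : forall x, N' (i x) -> N x).
Hypothesis psiD : forall x (a b : N x), psi (a + b) = psi a + psi b.
Hypothesis psi_act : forall x y (a : N x),
  psi (hm_act N x y a) = hcast N' (esym (cmh_mul i x y)) (hm_act N' (i x) (i y) (psi a)).
Hypotheses (psiK : forall x (a : N x), psiinv (psi a) = a)
  (psiinvK : forall x (b : N' (i x)), psi (psiinv b) = b).
Variable f : cochain2 N.
Hypotheses (fn : normal2 f)
  (fg : forall x y z, g x y z - psiinv (hcast N' (cmh_mul3 i x y z) (g' (i x) (i y) (i z))) =
        - hcast N (cmF4 x y z) (hm_act N (y ⊙ z) x (f y z)) + f (x ⊙ y) z
        - hcast N (cm_opA x y z) (f x (y ⊙ z)) + hm_act N (x ⊙ y) z (f x y))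
  (fmu : forall x y, mu x y - psiinv (hcast N' (esym (cmh_mul i x y)) (mu' (i x) (i y))) =
        f x y - hcast N (cm_opC y x) (f y x)).

Local Notation D := (crossed g mu).
Local Notation D' := (crossed g' mu').

(** The sign of [f] is dictated by the associativity square, where the constraints enter with signs
    opposite to those of the coboundary. *)
Definition induced_fun : smfun D D' :=
  @SMFun D D' i
    (fun x y (h : @xhom M N x y) => XHom (congr1 i (xh_eq h)) (psi (xh_val h)))
    (fun x y => XHom (esym (cmh_mul i x y)) (psi (- f x y)))
    (XHom (esym (cmh_one i)) 0).

Ltac mvgoal := apply: xhom_eq => /=; rewrite -[LHS](transp_id HN') -[RHS](transp_id HN')
  !(mapsimp HN' psiD psi_act) ?cm_opm1.

Lemma induced_smfun : is_smfun induced_fun.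
Proof.
case: fn => f1 f2.
split; first by move=> x; mvgoal.
split; first by move=> x y z h k; mvgoal; zmod.
split; first by move=> x y; apply: crossed_iso.
split; first exact: crossed_iso.
split.
  move=> x x' y y' [p a] [q b]; case: x' / p a => a; case: y' / q b => b.
  mvgoal; zmod.
split.
  move=> x y z; mvgoal.
  (* The image of the coboundary relation under [psi] is the associativity square. *)
  have /(congr1 (transp N' (i (x ⊙ (y ⊙ z))) cm_e \o @psi _)) /= := fg x y z.
  rewrite !(mapsimp HN' psiD psi_act) psiinvK !(mapsimp HN' psiD psi_act) ?cm_opm1 => E.
  apply: (eq_of_eq E); zmod.
split; first by move=> x; mvgoal; rewrite f1 map0 // transp0 //; zmod.
split; first by move=> x; mvgoal; rewrite f2 map0 // transp0 //; zmod.
move=> x y; mvgoal.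
have /(congr1 (transp N' (i (y ⊙ x)) cm_e \o @psi _)) /= := fmu x y.
rewrite !(mapsimp HN' psiD psi_act) psiinvK !(mapsimp HN' psiD psi_act) ?cm_opm1 => E.
apply: (eq_of_eq E); zmod.
Qed.

Lemma induced_equiv : bijective i -> sm_equiv D D'.
Proof.
case=> j ij ji.
apply: (ff_es_equiv (Z5_is_smag HN' Zg') induced_smfun).
- move=> x y h k /(congr1 (@xh_val _ _ _ _)) /= /(congr1 (@psiinv _)).
  by rewrite !psiK; apply: xhom_eq.
- move=> x y h; exists (XHom (can_inj ij (xh_eq h)) (psiinv (xh_val h))).
  by apply: xhom_eq; rewrite /= psiinvK.
- by move=> c; exists (j c); split; apply: XHom (ji c) 0.
Qed.

End InducedEquivalence.

(** * From an equivalence to its invariants *)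

Section EquivalenceInvariants.
Variables (M M' : comMonoid) (N : hmod M) (N' : hmod M').
Variables (g : cochain3 N) (mu : cochain2 N) (g' : cochain3 N') (mu' : cochain2 N').
Hypotheses (HN : is_hmod N) (HN' : is_hmod N').

Local Notation D := (crossed g mu).
Local Notation D' := (crossed g' mu').

Variables (F : smfun D D') (G : smfun D' D).
Hypothesis HF : is_smfun F.
Variables (th : forall x : D, hom (fob (smfun_comp G F) x) x)
          (th' : forall x : D', hom (fob (smfun_comp F G) x) x).
Hypotheses
  (Hth : is_smnatiso (F := smfun_comp G F) (G := smfun_id D) th)
  (Hth' : is_smnatiso (F := smfun_comp F G) (G := smfun_id D') th').

(** An arrow of a crossed product carries an equality of objects, so the monoidal constraints show
    that [fob F] is a homomorphism. *)
Definition equiv_hom : cmhom M M' :=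
  @CMHom M M' (fob F) (fun x y => esym (xh_eq (fphi F x y))) (esym (xh_eq (fphi0 F))).
Local Notation i := equiv_hom.

Lemma equiv_hom_bij : bijective i.
Proof.
by exists (fob G : M' -> M) => x; [exact: xh_eq (th x) | exact: xh_eq (th' x)].
Qed.

Definition xaut (K : comMonoid) (A : hmod K) (x : K) (a : A x) : @xhom K A x x := XHom erefl a.

Definition equiv_map (x : M) (a : N x) : N' (i x) := xh_val (fhom F (xaut a : @hom D x x)).
(** [fob G (fob F x)] equals [x] only propositionally, through [th x]; hence the cast. *)
Definition equiv_mapinv (x : M) (b : N' (i x)) : N x :=
  hcast N (xh_eq (th x)) (xh_val (fhom G (xaut b : @hom D' (i x) (i x)))).
Local Notation psi := equiv_map.
Local Notation psiinv := equiv_mapinv.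

Lemma fhom_val (x y : D) (h : hom x y) : xh_val (fhom F h) = psi (xh_val h).
Proof. by case: h => p a; case: y / p a. Qed.

Lemma equiv_mapD x (a b : N x) : psi (a + b) = psi a + psi b.
Proof.
have E : (xaut (a + b) : @hom D x x) = comp (xaut b : @hom D x x) (xaut a : @hom D x x) by [].
by rewrite /psi E (fun_comp HF) /= hcast_id.
Qed.

Lemma equiv_map0 x : psi (0 : N x) = 0.
Proof. by apply: (addIr (psi (0 : N x))); rewrite -equiv_mapD !add0r. Qed.

(** Naturality of the tensor constraint at [a] tensored with an identity; the constraint itself
    cancels. *)
Lemma equiv_map_act x y (a : N x) :
  psi (hm_act N x y a) = hcast N' (esym (cmh_mul i x y)) (hm_act N' (i x) (i y) (psi a)).
Proof.
have := fun_nat HF (xaut a : @hom D x x) (idm (y : D)).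
move=> /(congr1 (@xh_val _ _ _ _)) /= /(congr1 (transp N' (i (x ⊙ y)) cm_e)).
rewrite !fhom_val /= (act0 HN) !equiv_map0 hcast0 addr0.
rewrite !(transpsimp HN') ?cm_opm1 /= => E.
rewrite -[LHS](transp_id HN') -[RHS](transp_id HN') !(transpsimp HN') ?cm_opm1.
apply: (eq_of_eq E) => /=; zmod.
Qed.


Local Notation msimp := (mapsimp HN' equiv_mapD equiv_map_act).

Lemma equiv_mapK x (a : N x) : psiinv (psi a) = a.
Proof.
have /(congr1 (@xh_val _ _ _ _)) /= := Hth.2.1 _ _ (xaut a : @hom D x x).
have -> : fhom F (xaut a : @hom D x x) = xaut (psi a) by apply: xhom_eq.
(* The value of [th x] occurs on both sides of naturality and cancels. *)
by rewrite addrC => /addrI.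
Qed.

Lemma equiv_mapinvK x (b : N' (i x)) : psi (psiinv b) = b.
Proof.
have := Hth'.2.1 _ _ (xaut b : @hom D' (i x) (i x)).
move=> /(congr1 (@xh_val _ _ _ _)) /= /(congr1 (transp N' (i x) cm_e)).
rewrite fhom_val !msimp /= => E.
rewrite -[LHS](transp_id HN') -[RHS](transp_id HN') /psiinv !msimp.
apply: (eq_of_eq E) => /=; zmod.
Qed.

(* Adding (xy)_* φ₀ normalizes the tensor constraint φ; this correction is
   symmetric and has zero coboundary. *)
Definition equiv_cochain : cochain2 N := fun x y =>
  - psiinv (xh_val (fphi F x y) + transp N' (i (x ⊙ y)) (i (x ⊙ y)) (xh_val (fphi0 F))).
Local Notation f := equiv_cochain.

Lemma equiv_hom_unit (u : M') : i cm_e ⊙ u = u.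
Proof. by rewrite cmh_one cm_op1m. Qed.

Lemma transp_cochain w u x y :
  transp N' w u (psi (f x y)) =
  - (transp N' w u (xh_val (fphi F x y)) + transp N' w (i (x ⊙ y) ⊙ u) (xh_val (fphi0 F))).
Proof.
rewrite /f (mapN equiv_mapD) equiv_mapinvK !(transpsimp HN') (transp_transp HN') //.
exact: equiv_hom_unit.
Qed.

(** Moves identities in [N] to [N'], where the constraints of [F] take their values. *)
Lemma transp_psi_inj x (a b : N x) :
  transp N' (i x) cm_e (psi a) = transp N' (i x) cm_e (psi b) -> a = b.
Proof. by rewrite !(transp_id HN') => /(congr1 (@psiinv x)); rewrite !equiv_mapK. Qed.

(** Unit constraints of crossed products have value 0, so the unit squares of [F] say exactly that
    the corrected constraint vanishes. *)
Lemma equiv_cochain_normal : normal2 f.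
Proof.
split=> x; apply: transp_psi_inj; rewrite transp_cochain !msimp ?cm_opm1.
  have /(congr1 (@xh_val _ _ _ _)) /= := fun_lunit HF (x : D).
  move=> /(congr1 (transp N' (i (cm_e ⊙ x)) cm_e)).
  rewrite !fhom_val !msimp ?cm_opm1 /= => E.
  rewrite (transp_congr _ _ (congr1 i (cm_op1m x))).
  apply: (eq_of_eq (esym E)) => /=; zmod.
have /(congr1 (@xh_val _ _ _ _)) /= := fun_runit HF (x : D).
move=> /(congr1 (transp N' (i x) cm_e)).
rewrite !fhom_val !msimp (cm_opm1 (i x)) /= => E.
apply: (eq_of_eq (esym E)) => /=; zmod.
Qed.

Lemma equiv_cochain_assoc x y z :
  g x y z - pull_g (N := N) (i := i) psiinv g' x y z =
  - hcast N (cmF4 x y z) (hm_act N (y ⊙ z) x (f y z)) + f (x ⊙ y) z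
  - hcast N (cm_opA x y z) (f x (y ⊙ z)) + hm_act N (x ⊙ y) z (f x y).
Proof.
apply: transp_psi_inj; rewrite /pull_g; move: transp_cochain equiv_mapinvK.
(* Both become variables known only through [fE] and [psiinvK], which hides their definitions from
   rewriting. *)
move: equiv_cochain equiv_mapinv => f0 psiinv0 fE psiinvK.
rewrite !msimp psiinvK !msimp !fE ?cm_opm1.
have := congr1 (@xh_val _ _ _ _) (fun_assoc HF (x : D) (y : D) (z : D)).
move=> /= /(congr1 (transp N' (i (x ⊙ y ⊙ z)) cm_e)).
rewrite !fhom_val !msimp ?cm_opm1 /= => E.
(* The four corrections by [fphi0 F] must have the same acting element to cancel as atoms. *)
have c1 : i (y ⊙ z) ⊙ i x = i (x ⊙ y ⊙ z) by rewrite -cmh_mul cmF4.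
have c2 : i (x ⊙ y) ⊙ i z = i (x ⊙ y ⊙ z) by rewrite -cmh_mul.
have c3 : i (x ⊙ (y ⊙ z)) = i (x ⊙ y ⊙ z) by rewrite cm_opA.
rewrite !(transp_congr _ _ c1, transp_congr _ _ c2, transp_congr _ _ c3).
apply: (eq_of_eq E) => /=; zmod.
Qed.

Lemma equiv_cochain_braid x y :
  mu x y - pull_mu (N := N) (i := i) psiinv mu' x y = f x y - hcast N (cm_opC y x) (f y x).
Proof.
apply: transp_psi_inj; rewrite /pull_mu; move: transp_cochain equiv_mapinvK.
move: equiv_cochain equiv_mapinv => f0 psiinv0 fE psiinvK.
rewrite !msimp psiinvK !msimp !fE ?cm_opm1.
have := congr1 (@xh_val _ _ _ _) (fun_braid HF (x : D) (y : D)).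
move=> /= /(congr1 (transp N' (i (x ⊙ y)) cm_e)).
rewrite !fhom_val !msimp ?cm_opm1 /= => E.
rewrite (transp_congr _ _ (congr1 i (cm_opC y x))).
apply: (eq_of_eq E) => /=; zmod.
Qed.

Lemma equiv_invariants :
  exists (j : cmhom M M') (chi : forall x, N x -> pullback j N' x)
         (chiinv : forall x, pullback j N' x -> N x),
    bijective j /\ hmod_iso chi chiinv /\
    cohomologous g mu (pull_g chiinv g') (pull_mu chiinv mu').
Proof.
exists i, psi, psiinv; split; first exact: equiv_hom_bij.
split.
  split; first exact: equiv_mapD.
  split; first exact: equiv_map_act.
  split; [exact: equiv_mapK | exact: equiv_mapinvK].
exists f; split; first exact: equiv_cochain_normal.
split; [exact: equiv_cochain_assoc | exact: equiv_cochain_braid].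
Qed.

End EquivalenceInvariants.

Theorem theorem6p2 :
  (forall C : smag_data, is_smag C ->
     exists (M : comMonoid) (N : hmod M) (g : cochain3 N) (mu : cochain2 N),
       is_hmod N /\ Z5 g mu /\ sm_equiv (crossed g mu) C) /\
  (forall (M M' : comMonoid) (N : hmod M) (N' : hmod M')
          (g : cochain3 N) (mu : cochain2 N) (g' : cochain3 N') (mu' : cochain2 N'),
     is_hmod N -> is_hmod N' -> Z5 g mu -> Z5 g' mu' ->
     (sm_equiv (crossed g mu) (crossed g' mu') <->
      exists (i : cmhom M M') (psi : forall x, N x -> pullback i N' x)
             (psiinv : forall x, pullback i N' x -> N x),
        bijective i /\ hmod_iso psi psiinv /\
        cohomologous g mu (pull_g psiinv g') (pull_mu psiinv mu'))).
Proof.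
split; first exact: smag_crossed_equiv.
move=> M M' N N' g mu g' mu' HN HN' _ Zg'; split.
  by case=> F [G [HF [HG [[th Hth] [th' Hth']]]]]; apply: equiv_invariants Hth Hth'.
case=> i [psi [psiinv [bij_i [[psiD [psi_act [psiK psiinvK]]] [f [fn [fg fmu]]]]]]].
exact: (induced_equiv HN' Zg' psiD psi_act psiK psiinvK fn fg fmu bij_i).
Qed.
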